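(* There are no (signed) integers $K,M,C$ satisfying \[ 2K(K^2+3M^2)=C^3,\qquad KMC\neq 0,\qquad \gcd(K,M)=1,\qquad K+M\ \text{odd}. \] In particular, there are no pairwise coprime positive integers $a,b,c$ with $a^3+b^3=c^3$, $a<b<c$, $a$ and $b$ odd, and $c$ even. *)

(* Defs.v *)
From mathcomp Require Import all_boot all_order all_algebra.

Set Implicit Arguments.
Unset Strict Implicit.
Unset Printing Implicit Defensive.

(* Main.v *)
Require Import Defs.
From mathcomp Require Import all_boot all_order all_algebra.
From mathcomp Require Import ring zify.

Set Implicit Arguments.
Unset Strict Implicit.
Unset Printing Implicit Defensive.

Import Order.TTheory GRing.Theory Num.Theory.
Local Open Scope ring_scope.

(** Putting x = K - M and y = K + M turns 2 K (K^2 + 3 M^2) = C^3 into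
    x^3 + y^3 = C^3 with x and y odd and coprime, so both claims are instances
    of the cubic case of Fermat's Last Theorem. The proof is Euler's infinite
    descent on |C| ([no_KMC_solution]).

    If 3 does not divide K, the coprime factors 2 K and K^2 + 3 M^2 are both
    cubes; if it does, 6 K and (K^2 + 3 M^2) / 3 are. The heart of the matter is
    that an odd cube u^2 + 3 v^2 = n^3 with u, v coprime forces u + v sqrt(-3) to
    be the cube of some s + t sqrt(-3) ([form_cube]), although Z[sqrt(-3)] is not
    a unique factorization domain. The ratio r = u / v modulo n satisfies
    r^2 = -3; a descent on n produces an element a + b sqrt(-3) of norm n with
    a = r b modulo n ([sqr_add3_form]), and the congruence makes it divide
    u + v sqrt(-3). The quotient has norm n^2, is still primitive and lies in the
    same residue class r, because u + v sqrt(-3) is primitive ([form_factor]).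
    So the same a + b sqrt(-3) divides three times, and a unit, which is 1 or -1,
    remains.

    Expanding the cube writes 2 K or 6 K, up to a cube factor, as the product
    2 X (X - W) (X + W) of three pairwise coprime integers ([split_descent]).
    They are therefore cubes z^3, x^3, y^3 with x^3 + y^3 = z^3
    ([cubes_of_sqr_diff]): a new solution, with z smaller than C in absolute
    value. *)

(** * Coprime integers and cubes *)

Lemma coprime2z (x : int) : coprimez 2 x = ~~ (2 %| x)%Z.
Proof. rewrite coprimezE /dvdz /= coprime2n; lia. Qed.

Lemma coprimezMDl (q m n : int) : coprimez m (q * m + n) = coprimez m n.
Proof. by rewrite /coprimez gcdzMDl. Qed.

Lemma coprimezDl (m n : int) : coprimez m (m + n) = coprimez m n.
Proof. by rewrite /coprimez gcdzDl. Qed.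

Lemma dvdz_coprimel (d m n : int) :
  (d %| m)%Z -> coprimez m n -> coprimez d n.
Proof. exact: coprime_dvdl. Qed.

Lemma dvdz_coprimer (d m n : int) :
  (d %| m)%Z -> coprimez n m -> coprimez n d.
Proof. exact: coprime_dvdr. Qed.

(** The cube root of [a] is the gcd [g] of [a] and [c], up to a sign that the
    cube absorbs: writing a = g a', the numbers a' and g^2 divide each other. *)
Lemma coprime_mul_cube (a b c : int) :
  coprimez a b -> a * b = c ^+ 3 -> exists d, a = d ^+ 3.
Proof.
move=> cop_ab abc; have [->|a_nz] := eqVneq a 0; first by exists 0.
set g := gcdz a c.
have /dvdzP[a' def_a] : (g %| a)%Z by apply: dvdz_gcdl.
have /dvdzP[c' def_c] : (g %| c)%Z by apply: dvdz_gcdr.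
have g_nz : g != 0 by apply: contra_neq a_nz => g0; rewrite def_a g0 mulr0.
have cop_ac : coprimez a' c'.
  apply/coprimezP; have [u [v uvg]] := Bezoutz a c; exists (u, v) => /=.
  apply: (mulIf g_nz); rewrite mul1r -/g in uvg *.
  by rewrite -[RHS]uvg {1}def_a {1}def_c; ring.
have a'b : a' * b = g ^+ 2 * c' ^+ 3.
  apply: (mulIf g_nz); transitivity (a * b); first by rewrite {1}def_a; ring.
  by rewrite abc {1}def_c; ring.
have a'_dvd : (a' %| g ^+ 2)%Z.
  by rewrite -(Gauss_dvdzl _ (coprimezXr 3 cop_ac)) -a'b dvdz_mulr.
(* [b] is prime to [a], hence to its divisor [g] *)
have dvd_a' : (g ^+ 2 %| a')%Z.
  have cop_gb : coprimez g b by apply: dvdz_coprimel cop_ab; apply: dvdz_gcdl.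
  by rewrite -(Gauss_dvdzl _ (coprimezXl 2 cop_gb)) a'b dvdz_mulr.
have /eqP eq_abs : (`|a'| == `|g ^+ 2|)%N by rewrite eqn_dvd -!dvdzE a'_dvd.
have [a'E|a'E] : a' = g ^+ 2 \/ a' = - g ^+ 2.
- by move: eq_abs; clear; move: (g ^+ 2) => h; lia.
- by exists g; rewrite def_a a'E; ring.
- by exists (- g); rewrite def_a a'E; ring.
Qed.

(** * Arithmetic of the form x^2 + 3 y^2 *)

(** Descent on [n]: after shifting [r] by a multiple of [n] to make it even and
    less than [n] in absolute value, the cofactor [m] in r^2 + 3 = m n is odd and
    smaller than [n]. An element c + d sqrt(-3) of norm [m] whose ratio is [r]
    modulo [m] divides r + sqrt(-3), and the quotient a + b sqrt(-3) has norm
    [n]. Keeping the cofactors odd is essential, since 2 divides 1 + 3 but is not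
    of the form a^2 + 3 b^2. *)
Lemma sqr_add3_form (n r : int) : 0 < n -> ~~ (2 %| n)%Z -> (n %| r ^+ 2 + 3)%Z ->
  exists a b, n = a ^+ 2 + 3 * b ^+ 2 /\ (n %| a - r * b)%Z.
Proof.
have [N] := ubnP `|n|%N; elim: N => // N IHN in n r *.
rewrite ltnS => leN n_gt0 n_odd dvd_n.
have [->|n_neq1] := eqVneq n 1; first by exists 1, 0; rewrite dvd1z.
have [r' [q [def_r r'_lt r'_even]]] :
    exists r' q, [/\ r = r' + q * n, `|r'| < n & (2 %| r')%Z].
  have def_r := divz_eq r n; have r_ge0 : 0 <= (r %% n)%Z by lia.
  have r_lt := ltz_pmod r n_gt0.
  have [ev|od] := boolP (2 %| (r %% n)%Z)%Z.
    by exists (r %% n)%Z, (r %/ n)%Z; split=> //; lia.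
  by exists ((r %% n)%Z - n), ((r %/ n)%Z + 1); split; [lia | lia | lia].
have /dvdzP[m def_m] : (n %| r' ^+ 2 + 3)%Z.
  have -> : r' ^+ 2 + 3 = r ^+ 2 + 3 - n * (q * (r + r')) by rewrite def_r; ring.
  by rewrite rpredB // dvdz_mulr.
have m_gt0 : 0 < m by nia.
have m_lt : m < n by nia.
have m_odd : ~~ (2 %| m)%Z.
  apply/dvdzP => -[f def_f]; case/dvdzP: r'_even => e def_e.
  by move: def_m; rewrite def_f def_e; lia.
have [||||c [d [def_m2 /dvdzP[b def_b]]]] := IHN m r' => //; first by lia.
  by rewrite def_m dvdz_mulr.
have m_nz : m != 0 by lia.
(* the real part (r' c + 3 d) / m of the quotient, cleared of division *)
pose a := r' * b + d * n.
have def_a : a * m = r' * c + 3 * d.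
  have cE : c = b * m + r' * d by rewrite -def_b; ring.
  transitivity (r' * (b * m) + d * (n * m)); first by rewrite /a; ring.
  by rewrite [n * m]mulrC -def_m -def_b; ring.
exists a, b; split.
  apply: (mulIf (expf_neq0 2 m_nz)).
  transitivity ((m * n) * m); first by ring.
  rewrite -def_m.
  transitivity ((a * m) ^+ 2 + 3 * (b * m) ^+ 2); last by ring.
  by rewrite def_a -def_b {1}def_m2; ring.
by apply/dvdzP; exists (d - q * b); rewrite def_r /a; ring.
Qed.

Lemma form_coprime (u v n : int) :
  coprimez u v -> (n %| u ^+ 2 + 3 * v ^+ 2)%Z -> coprimez v n.
Proof.
move=> cop dvd_n; apply: (dvdz_coprimer dvd_n).
have -> : u ^+ 2 + 3 * v ^+ 2 = 3 * v * v + u ^+ 2 by ring.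
by rewrite coprimezMDl coprimezXr // coprimez_sym.
Qed.

(** Multiplicativity of the norm: the quotient of u + v sqrt(-3) by
    a + b sqrt(-3) is ((u a + 3 v b) + (v a - u b) sqrt(-3)) / n. The last
    conclusion lets the division be repeated with the same divisor: [n] divides
    (u1 b - v1 a) (u1 b + v1 a) when it divides the new norm, and the second
    factor is [v], which is prime to [n]. Without primitivity the quotient could
    call for the conjugate a - b sqrt(-3) instead. *)
Lemma form_factor (a b n N u v : int) :
    n = a ^+ 2 + 3 * b ^+ 2 -> n != 0 -> coprimez u v ->
    u ^+ 2 + 3 * v ^+ 2 = n * N -> (n %| u * b - v * a)%Z ->
  exists u1 v1, [/\ u = u1 * a - 3 * v1 * b, v = u1 * b + v1 * a,
    u1 ^+ 2 + 3 * v1 ^+ 2 = N, coprimez u1 v1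
    & (n %| N)%Z -> (n %| u1 * b - v1 * a)%Z].
Proof.
move=> def_n n_nz cop_uv def_N dvd1.
have norm_mul : (u * a + 3 * v * b) ^+ 2
    = n ^+ 2 * N - 3 * (u * b - v * a) ^+ 2.
  transitivity (n * (n * N) - 3 * (u * b - v * a) ^+ 2); last by ring.
  by rewrite -def_N {1}def_n; ring.
have /dvdzP[u1 def_u1] : (n %| u * a + 3 * v * b)%Z.
  rewrite -(@dvdz_pexp2r _ _ 2) // norm_mul.
  by apply: rpredB; [apply: dvdz_mulr | apply/dvdz_mull/dvdz_exp2r].
case/dvdzP: dvd1 => w def_w; pose v1 := - w.
have v1E : v1 * n = v * a - u * b by rewrite /v1 mulNr -def_w; ring.
have uE : u = u1 * a - 3 * v1 * b.
  apply: (mulIf n_nz); transitivity (u1 * n * a - 3 * (v1 * n) * b).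
    by rewrite -def_u1 v1E {1}def_n; ring.
  by ring.
have vE : v = u1 * b + v1 * a.
  apply: (mulIf n_nz); transitivity (u1 * n * b + (v1 * n) * a).
    by rewrite -def_u1 v1E {1}def_n; ring.
  by ring.
have NE : u1 ^+ 2 + 3 * v1 ^+ 2 = N.
  by apply: (mulfI n_nz); rewrite -def_N uE vE {1}def_n; ring.
exists u1, v1; split=> //.
  apply/coprimezP; case/coprimezP: cop_uv => -[p q] /= pq1.
  exists (p * a + q * b, q * a - 3 * p * b) => /=.
  by rewrite -[RHS]pq1 uE vE; ring.
move=> dvd_nN.
have cop_vn : coprimez n v.
  by rewrite coprimez_sym; apply: form_coprime cop_uv _; rewrite def_N dvdz_mulr.
rewrite -(Gauss_dvdzr _ cop_vn).
have -> : v * (u1 * b - v1 * a) = b ^+ 2 * N - v1 ^+ 2 * n.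
  by rewrite vE -NE {1}def_n; ring.
by rewrite rpredB // dvdz_mull.
Qed.

Lemma form_odd (u v : int) :
  ~~ (2 %| u + v)%Z -> ~~ (2 %| u ^+ 2 + 3 * v ^+ 2)%Z.
Proof.
move=> odd_uv; apply/dvdzP => -[f fE].
have [e uE] : exists e, u = 2 * e + 1 - v by exists ((u + v) %/ 2)%Z; lia.
by move: fE; rewrite uE; lia.
Qed.

(** The element u + v sqrt(-3) is the cube of s + t sqrt(-3), in coordinates:
    it is divisible three times by the same element of norm [n], and the sign
    that remains is moved into the cube. *)
Lemma form_cube (u v n : int) : coprimez u v -> ~~ (2 %| u + v)%Z ->
    u ^+ 2 + 3 * v ^+ 2 = n ^+ 3 ->
  exists s t, [/\ u = s * (s ^+ 2 - 9 * t ^+ 2), v = 3 * t * (s ^+ 2 - t ^+ 2)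
    & n = s ^+ 2 + 3 * t ^+ 2].
Proof.
move=> cop_uv odd_uv def_n.
have n_gt0 : 0 < n.
  have : 0 < n ^+ 3.
    rewrite -def_n; have [[u0 v0]|uv_nz] : u = 0 /\ v = 0 \/ (u != 0 \/ v != 0) by lia.
      by move: odd_uv; rewrite u0 v0.
    by nia.
  by nia.
have n_nz : n != 0 by lia.
have n_odd : ~~ (2 %| n)%Z.
  by apply: contra (form_odd odd_uv) => n_even; rewrite def_n dvdz_exp.
have n_dvd : (n %| u ^+ 2 + 3 * v ^+ 2)%Z by rewrite def_n dvdz_exp.
have cop_vn := form_coprime cop_uv n_dvd.
(* [p] inverts [v] modulo [n], so [u * p] is a square root of -3 modulo [n] *)
case/coprimezP: (cop_vn) => -[p q] /= pq1.
have [] := @sqr_add3_form n (u * p) n_gt0 n_odd.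
  have -> : (u * p) ^+ 2 + 3
      = p ^+ 2 * (u ^+ 2 + 3 * v ^+ 2) + n * (3 * q * (1 + p * v)).
    have qE : n * q = 1 - p * v by rewrite -pq1; ring.
    transitivity ((u * p) ^+ 2 + 3 * (p * v) ^+ 2 + 3 * (n * q) * (1 + p * v)).
      by rewrite qE; ring.
    by ring.
  by apply: rpredD; [apply: dvdz_mull | apply: dvdz_mulr].
move=> a [b [nE dvd_ab]].
have dvd_uv : (n %| u * b - v * a)%Z.
  have -> : u * b - v * a = n * (u * b * q) - v * (a - u * p * b).
    transitivity (u * b * (p * v + q * n) - v * a); last by ring.
    by rewrite pq1 mulr1.
  by apply: rpredB; [apply: dvdz_mulr | apply: dvdz_mull].
have n3 : u ^+ 2 + 3 * v ^+ 2 = n * n ^+ 2 by rewrite def_n; ring.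
have [u1 [v1 [-> -> n2 cop1 dvd1]]] := form_factor nE n_nz cop_uv n3 dvd_uv.
have [||u2 [v2 [-> -> n1 cop2 dvd2]]] := form_factor (N := n) nE n_nz cop1.
- by rewrite n2; ring.
- by apply: dvd1; rewrite dvdz_exp.
have [||u3 [v3 [-> -> n0 _ _]]] := form_factor (N := 1) nE n_nz cop2.
- by rewrite n1 mulr1.
- exact: dvd2.
(* the last quotient has norm 1, hence is 1 or -1, and equals its own cube *)
have v30 : v3 = 0 by move: n0; clear; nia.
have u31 : u3 = 1 \/ u3 = -1 by move: n0; rewrite v30; clear; nia.
exists (u3 * a), (u3 * b); rewrite v30 nE.
by case: u31 => ->; split; ring.
Qed.

(** * Euler's descent *)

(** The factors 2 X, X - W, X + W are pairwise coprime, X - W and X + W being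
    odd. Since 2 X is the sum of the other two, z^3 = x^3 + y^3. *)
Lemma cubes_of_sqr_diff (X W c : int) : coprimez X W -> ~~ (2 %| X + W)%Z ->
    2 * X * (X ^+ 2 - W ^+ 2) = c ^+ 3 ->
  exists x y z, [/\ 2 * X = z ^+ 3, X - W = x ^+ 3, X + W = y ^+ 3 & coprimez x y].
Proof.
move=> cop odd_sum prod.
have copXp : coprimez X (X + W) by rewrite coprimezDl.
have copXm : coprimez X (X - W) by rewrite coprimezDl coprimezN.
have cop2p : coprimez (2 * X) (X + W) by rewrite coprimezMl coprime2z odd_sum.
have cop2m : coprimez (2 * X) (X - W).
  by rewrite coprimezMl copXm coprime2z andbT; lia.
have copmp : coprimez (X - W) (X + W).
  have -> : X + W = -1 * (X - W) + 2 * X by ring.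
  by rewrite coprimezMDl coprimez_sym.
have [z zE] : exists z, 2 * X = z ^+ 3.
  apply: (@coprime_mul_cube _ ((X - W) * (X + W)) c); first by rewrite coprimezMr cop2m.
  by rewrite -prod; ring.
have [x xE] : exists x, X - W = x ^+ 3.
  apply: (@coprime_mul_cube _ (2 * X * (X + W)) c); last by rewrite -prod; ring.
  by rewrite coprimezMr copmp coprimez_sym cop2m.
have [y yE] : exists y, X + W = y ^+ 3.
  apply: (@coprime_mul_cube _ (2 * X * (X - W)) c); last by rewrite -prod; ring.
  by rewrite coprimezMr coprimez_sym cop2p coprimez_sym.
exists x, y, z; split=> //.
by move: copmp; rewrite xE yE coprimez_pexpl // coprimez_pexpr.
Qed.

(** With s, t given by [form_cube], K = s (s - 3 t) (s + 3 t) when 3 does not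
    divide [K]; take X = s and W = 3 t. When K = 3 k, the roles of the two terms
    are exchanged, since K^2 + 3 M^2 = 3 (M^2 + 3 k^2) and
    k = 3 t (s - t) (s + t); take X = t and W = s. The bound on [Q]
    makes the cube root of 2 X smaller than [C] in absolute value. *)
Lemma split_descent (K M C : int) :
    2 * K * (K ^+ 2 + 3 * M ^+ 2) = C ^+ 3 -> K * M * C != 0 ->
    coprimez K M -> ~~ (2 %| K + M)%Z ->
  exists X W c Q, [/\ 2 * X * (X ^+ 2 - W ^+ 2) = c ^+ 3, X != 0 /\ W != 0,
    coprimez X W, ~~ (2 %| X + W)%Z & C ^+ 3 = 2 * X * Q /\ 1 < `|Q|].
Proof.
move=> eqC nz cop odd_KM.
have [K_nz M_nz] : K != 0 /\ M != 0.
  by move: nz; rewrite !mulf_eq0 !negb_or => /andP[/andP[]].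
have [/dvdzP[k kE]|K_3] := boolP (3 %| K)%Z.
  have cop_Mk : coprimez M k.
    apply: (dvdz_coprimer (_ : (k %| K)%Z)); first by rewrite kE dvdz_mulr.
    by rewrite coprimez_sym.
  have cop_3M : coprimez 3 M.
    by apply: (dvdz_coprimel (_ : (3 %| K)%Z)); rewrite // kE dvdz_mull.
  have odd_Mk : ~~ (2 %| M + k)%Z by lia.
  have cop_form : coprimez (18 * k) (M ^+ 2 + 3 * k ^+ 2).
    have -> : 18 * k = 2 * (3 ^+ 2 * k) by ring.
    have cop_k := form_coprime cop_Mk (dvdzz _).
    have cop_3 : coprimez (3 ^+ 2) (M ^+ 2 + 3 * k ^+ 2).
      by rewrite coprimezXl // addrC mulrC coprimezMDl coprimezXr.
    by rewrite coprimezMl coprime2z form_odd //= coprimezMl cop_3.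
  have eqk : 18 * k * (M ^+ 2 + 3 * k ^+ 2) = C ^+ 3 by rewrite -eqC kE; ring.
  have [d dE] := coprime_mul_cube cop_form eqk.
  have [n nE] : exists n, M ^+ 2 + 3 * k ^+ 2 = n ^+ 3.
    by apply: (@coprime_mul_cube _ (18 * k) C); rewrite 1?coprimez_sym // mulrC.
  have [s [t [ME kE2 nE2]]] := form_cube cop_Mk odd_Mk nE.
  (* 18 k = 27 * 2 t (s^2 - t^2), so the factor 27 can be removed from [d ^+ 3] *)
  have /dvdzP[c cE] : (3 %| d)%Z.
    rewrite -(@dvdz_pexp2r _ _ 3) // -dE kE2; apply/dvdzP.
    by exists (2 * t * (s ^+ 2 - t ^+ 2)); ring.
  have [s_nz t_nz st_nz] : [/\ s != 0, t != 0 & s ^+ 2 - t ^+ 2 != 0].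
    split; first by apply: contra_neq M_nz => s0; rewrite ME s0 mul0r.
      by apply: contra_neq K_nz => t0; rewrite kE kE2 t0 !(mulr0, mul0r).
    by apply: contra_neq K_nz => t0; rewrite kE kE2 t0 !(mulr0, mul0r).
  exists t, s, (- c), (27 * (s ^+ 2 - t ^+ 2) * n ^+ 3); split=> //.
  - have c3E : 2 * t * (s ^+ 2 - t ^+ 2) = c ^+ 3.
      apply: (@mulfI _ 27) => //; transitivity (d ^+ 3); last by rewrite cE; ring.
      by rewrite -dE kE2; ring.
    transitivity (- (2 * t * (s ^+ 2 - t ^+ 2))); first by ring.
    by rewrite c3E; ring.
  - apply: (dvdz_coprimel (_ : (t %| k)%Z)).
      by rewrite kE2 -mulrA mulrCA dvdz_mulr.
    by apply: (dvdz_coprimer (_ : (s %| M)%Z)); rewrite 1?coprimez_sym // ME dvdz_mulr.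
  - apply: contra odd_KM => /dvdzP[e eE].
    have sE : s = 2 * e - t by rewrite mulrC -eE; ring.
    apply/dvdzP; exists (9 * t * (2 * e - 2 * t) * e + s * (e - 2 * t) * (2 * e + 2 * t)).
    by rewrite kE kE2 ME sE; ring.
  split; first by rewrite -eqk nE kE2; ring.
  have n_nz : n != 0 by rewrite nE2; move: s_nz; clear; nia.
  move: (mulf_neq0 st_nz (expf_neq0 3 n_nz)); rewrite -mulrA; clear.
  by move: (_ * n ^+ 3) => q; lia.
have cop_3K : coprimez 3 K.
  by rewrite coprimezE prime_coprime.
have cop_form : coprimez (2 * K) (K ^+ 2 + 3 * M ^+ 2).
  rewrite coprimezMl coprime2z form_odd //= exprS expr1 coprimezMDl.
  by rewrite coprimezMr coprimezXr // coprimez_sym cop_3K.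
have [d dE] := coprime_mul_cube cop_form eqC.
have [n nE] : exists n, K ^+ 2 + 3 * M ^+ 2 = n ^+ 3.
  by apply: (@coprime_mul_cube _ (2 * K) C); rewrite 1?coprimez_sym // mulrC.
have [s [t [KE ME nE2]]] := form_cube cop odd_KM nE.
have [s_nz t_nz st_nz] : [/\ s != 0, t != 0 & s ^+ 2 - 9 * t ^+ 2 != 0].
  split; first by apply: contra_neq K_nz => s0; rewrite KE s0 mul0r.
    by apply: contra_neq M_nz => t0; rewrite ME t0 !(mulr0, mul0r).
  by apply: contra_neq K_nz => t0; rewrite KE t0 mulr0.
exists s, (3 * t), d, ((s ^+ 2 - 9 * t ^+ 2) * n ^+ 3); split.
- by rewrite -dE KE; ring.
- by split=> //; rewrite mulf_neq0.
- apply: (dvdz_coprimel (_ : (s %| K)%Z)); first by rewrite KE dvdz_mulr.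
  by apply: (dvdz_coprimer (_ : (3 * t %| M)%Z)); rewrite // ME dvdz_mulr.
- apply: contra odd_KM => /dvdzP[e eE].
  have sE : s = 2 * e - 3 * t by rewrite mulrC -eE; ring.
  apply/dvdzP; exists (s * (s - 3 * t) * e + 3 * t * (e - 2 * t) * (2 * e - 2 * t)).
  by rewrite KE ME sE; ring.
split; first by rewrite -eqC nE KE; ring.
have n_gt : 1 < n by rewrite nE2; move: s_nz t_nz; clear; nia.
have n3_gt : 1 < n ^+ 3 by rewrite exprn_egt1.
move: st_nz n3_gt; rewrite normrM; clear.
by move: (n ^+ 3) (_ - _) => p q; nia.
Qed.

Lemma KMC_of_cubes (x y z : int) : x ^+ 3 + y ^+ 3 = z ^+ 3 ->
    ~~ (2 %| x)%Z -> ~~ (2 %| y)%Z -> coprimez x y -> x != y -> z != 0 ->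
  exists K M, [/\ 2 * K * (K ^+ 2 + 3 * M ^+ 2) = z ^+ 3, K * M * z != 0,
    coprimez K M & ~~ (2 %| K + M)%Z].
Proof.
move=> eqz odd_x odd_y cop xy z_nz.
pose K := ((x + y) %/ 2)%Z; pose M := ((y - x) %/ 2)%Z.
have xE : x = K - M by rewrite /K /M; lia.
have yE : y = K + M by rewrite /K /M; lia.
have eqK : 2 * K * (K ^+ 2 + 3 * M ^+ 2) = z ^+ 3 by rewrite -eqz xE yE; ring.
exists K, M; split=> //.
- rewrite !mulf_neq0 //; last by lia.
  by apply: contra_neq (expf_neq0 3 z_nz) => K0; rewrite -eqK K0 mulr0 mul0r.
- case/coprimezP: cop => -[p q] /= pq1; apply/coprimezP.
  by exists (p + q, q - p) => /=; rewrite -pq1 xE yE; ring.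
- by rewrite -yE.
Qed.

Lemma no_KMC_solution (K M C : int) :
    2 * K * (K ^+ 2 + 3 * M ^+ 2) = C ^+ 3 -> K * M * C != 0 ->
    coprimez K M -> ~~ (2 %| K + M)%Z -> False.
Proof.
have [N] := ubnP `|C|%N; elim: N => // N IHN in K M C *.
rewrite ltnS => leN eqC nz cop odd_KM.
have [X [W [c [Q [eqc [X_nz W_nz] copXW odd_XW [CE Q_gt]]]]]] :=
  split_descent eqC nz cop odd_KM.
have [x [y [z [zE xE yE cop_xy]]]] := cubes_of_sqr_diff copXW odd_XW eqc.
have odd_root (w : int) : ~~ (2 %| w ^+ 3)%Z -> ~~ (2 %| w)%Z.
  by apply: contra; apply: dvdz_exp.
have z_nz : z != 0.
  apply: contra_neq X_nz => z0.
  by apply: (@mulfI _ 2) => //; rewrite zE z0 mulr0.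
have [||||||K' [M' [eqz nz' cop' odd']]] := @KMC_of_cubes x y z => //.
- by rewrite -xE -yE -zE; ring.
- by apply: odd_root; rewrite -xE; move: odd_XW; clear; lia.
- by apply: odd_root; rewrite -yE.
- apply: contra_neq W_nz => xy.
  by move: xE; rewrite xy -yE; clear; lia.
apply: (IHN K' M' z) => //.
suff lt_zC : `|z| < `|C| by move: lt_zC leN; clear; lia.
rewrite -(@ltr_pXn2r _ 3) // -!normrX CE zE [`|_ * Q|]normrM ltr_pMr // normr_gt0.
exact: expf_neq0.
Qed.

Theorem theorem3p2 :
  (~ exists K M C : int,
      [/\ 2 * K * (K ^+ 2 + 3 * M ^+ 2) = C ^+ 3,
          K * M * C <> 0,
          gcdz K M = 1
        & ~~ (2 %| K + M)%Z])
  /\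
  (~ exists a b c : nat,
      [/\ [/\ (0 < a)%N, (0 < b)%N & (0 < c)%N],
          [/\ coprime a b, coprime a c & coprime b c],
          (a ^ 3 + b ^ 3 = c ^ 3)%N,
          (a < b < c)%N
        & [/\ odd a, odd b & ~~ odd c]]).
Proof.
split=> [[K [M [C [eqC /eqP nz /eqP cop odd_KM]]]] |].
  exact: no_KMC_solution eqC nz cop odd_KM.
move=> [a [b [c [[a0 b0 c0] [cop _ _] eqc /andP[ab _] [odd_a odd_b _]]]]].
have [||||||K [M [eqz nz cop' odd']]] := @KMC_of_cubes a b c.
- by move: eqc; clear; lia.
- by lia.
- by lia.
- by [].
- by lia.
- by lia.
exact: no_KMC_solution eqz nz cop' odd'.
Qed.
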